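(* Consider the DC power flow model on a grid $\mathcal G$ with independent Gaussian nodal injection fluctuations. Let $(ij)$ be an edge of $\mathcal G$ and let $\mathcal K$ be the set of nodes that are neighbors of both $i$ and $j$ in $\mathcal G$. Write $\sigma_a=\Sigma_p(a,a)$ and $\beta_a=\sum_{k:(ak)\text{ a line}}\beta_{ak}$. Then $\Sigma_\theta^{-1}(i,j)<0$ if $$\beta_{ij}>-\frac{\sigma_j(\beta_i-\beta_{ij})+\sigma_i(\beta_j-\beta_{ij})}{2(\sigma_i+\sigma_j)}+\sqrt{\left(\frac{\sigma_j(\beta_i-\beta_{ij})+\sigma_i(\beta_j-\beta_{ij})}{2(\sigma_i+\sigma_j)}\right)^2+\frac{\sigma_i\sigma_j}{\sigma_i+\sigma_j}\sum_{k\in\mathcal K}\frac{\beta_{ik}\beta_{jk}}{\sigma_k}}.$$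
   Context: Power grid: a finite connected simple undirected graph with $N$ non-reference buses and one reference bus; each line $(ij)$ has susceptance $\beta_{ij}=\beta_{ji}>0$. The reference bus is ignored in the analysis: $\mathcal G$ denotes the graph on the $N$ non-reference buses, with the lines between them as edges (so $\mathcal K$ consists of non-reference buses), while $\beta_a$ is the sum of the susceptances of all lines at $a$, including a line to the reference bus. Reduced weighted Laplacian $H_\beta\in\mathbb R^{N\times N}$: $H_\beta(i,i)=\beta_i$, $H_\beta(i,j)=-\beta_{ij}$ if $(ij)$ is a line between distinct non-reference buses, and $0$ otherwise. $H_\beta$ is invertible. DC power flow model: $p=H_\beta\theta$, with $p\sim\mathcal N(0,\Sigma_p)$ the active injections, $\Sigma_p$ diagonal with positive diagonal entries, and $\theta$ the phase angles; the covariance matrix of $\theta$ is $\Sigma_\theta=H_\beta^{-1}\Sigma_pH_\beta^{-1}$. *)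

(* Defs.v *)
From HB Require Import structures.
From mathcomp Require Export all_boot all_order all_algebra.
From mathcomp Require Export all_classical all_reals all_analysis.

Set Implicit Arguments.
Unset Strict Implicit.
Unset Printing Implicit Defensive.

Import Order.TTheory GRing.Theory Num.Theory.
Import numFieldNormedType.Exports.

Local Open Scope ring_scope.

(* Buses are [option 'I_N]: [None] is the reference bus, the [Some a] are the
   N non-reference buses. The value of [susc] off the lines is arbitrary and is
   never used. *)
Record grid (R : realType) (N : nat) := Grid {
  line : rel (option 'I_N);
  susc : option 'I_N -> option 'I_N -> R;
  line_sym : symmetric line;
  line_irr : irreflexive line;
  line_connected : forall a b, connect line a b;
  susc_sym : forall a b, line a b -> susc a b = susc b a;
  susc_gt0 : forall a b, line a b -> 0 < susc a b
}.

(* The graph induced on the non-reference buses. *)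
Definition edge (R : realType) (N : nat) (G : grid R N) : rel 'I_N :=
  fun a b => line G (Some a) (Some b).

Definition bus_susc (R : realType) (N : nat) (G : grid R N)
    (a b : 'I_N) : R :=
  susc G (Some a) (Some b).

(* The sum ranges over all lines at [a], the one to the reference bus
   included. *)
Definition total_susc (R : realType) (N : nat) (G : grid R N) (a : 'I_N) : R :=
  \sum_(k : option 'I_N | line G (Some a) k) susc G (Some a) k.

Definition reduced_laplacian (R : realType) (N : nat) (G : grid R N) :
    'M[R]_N :=
  \matrix_(a, b) if a == b then total_susc G a
                 else if edge G a b then - bus_susc G a b
                 else 0.

Definition common_neighbors (R : realType) (N : nat) (G : grid R N)
    (i j : 'I_N) : {set 'I_N} :=
  [set k | edge G i k && edge G j k]%SET.

(* The normal law of mean [m] and variance [v]. The library's [normal_prob] is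
   parametrized by the standard deviation, and is not the Dirac mass when that
   is 0. *)
Definition normal_law (R : realType) (m v : R)
    (A : set (measurableTypeR R)) : \bar R :=
  if v == 0 then \d_m A else normal_prob m (Num.sqrt v) A.

(* X ~ N(m, S): S is symmetric positive semidefinite, and every linear
   combination u X has law N(u m, u S u^T). *)
Definition gaussian_vector (d : measure_display) (T : measurableType d)
    (R : realType) (P : probability T R) (n : nat) (X : 'I_n -> {RV P >-> R})
    (m : 'cV[R]_n) (S : 'M[R]_n) : Prop :=
  [/\ S^T = S,
      forall u : 'rV[R]_n, 0 <= (u *m S *m u^T) 0 0 &
      forall (u : 'rV[R]_n) (A : set (measurableTypeR R)), measurable A ->
        P ((fun w => \sum_a u 0 a * X a w) @^-1` A)%classic =
        normal_law ((u *m m) 0 0) ((u *m S *m u^T) 0 0) A].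

Definition covariance_mx (d : measure_display) (T : measurableType d)
    (R : realType) (P : probability T R) (n : nat) (X : 'I_n -> {RV P >-> R}) :
    'M[R]_n :=
  \matrix_(a, b) fine (covariance P (X a) (X b)).

(* The injections have independent Gaussian fluctuations of zero mean
   (independence is the diagonality of their covariance matrix), and
   p = H theta at every outcome. *)
Definition dc_power_flow (d : measure_display) (T : measurableType d)
    (R : realType) (P : probability T R) (N : nat) (G : grid R N)
    (Sigma_p : 'M[R]_N) (p theta : 'I_N -> {RV P >-> R}) : Prop :=
  [/\ is_diag_mx Sigma_p,
      forall a, 0 < Sigma_p a a,
      gaussian_vector p 0 Sigma_p &
      forall w, \col_a p a w = reduced_laplacian G *m \col_a theta a w].

(* Main.v *)
(* The maximum principle makes H invertible, so theta = H^-1 p and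
   Sigma_theta = H^-1 Sigma_p H^-1, whose inverse is H Sigma_p^-1 H. For a line
   (ij) its (i,j) entry is
     sum_(k in K) beta_ik beta_jk / sigma_k
       - beta_ij (beta_i / sigma_i + beta_j / sigma_j),
   and the hypothesis says that beta_ij exceeds the larger root of the quadratic
   expressing its negativity.

   Only the sign matters, so the covariances of linear combinations of the
   injections are needed only up to a common positive factor: a combination
   u p of variance v > 0 is sqrt v times a standard normal variable, whence
   E[(u p)^2] = m2 * u Sigma_p u^T, m2 being the second moment of N(0, 1), and
   polarization gives the covariances. That 0 < m2 < +oo suffices. *)

Require Import Defs.
From HB Require Import structures.
From mathcomp Require Import all_boot all_order all_algebra.
From mathcomp Require Import all_classical all_reals all_analysis.
From mathcomp Require Import measurable_realfun.
From mathcomp Require Import ring lra.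

Set Implicit Arguments.
Unset Strict Implicit.
Unset Printing Implicit Defensive.

Import Order.TTheory GRing.Theory Num.Theory.
Import numFieldNormedType.Exports.

Local Open Scope ring_scope.

(** * Symmetry and invertibility of the reduced Laplacian *)

Lemma big_option (V : nmodType) (I : finType) (F : option I -> V) :
  \sum_k F k = F None + \sum_i F (Some i).
Proof.
rewrite (bigD1 None) //= (reindex_omap Some id) /=; last by case.
by congr (_ + _); apply: eq_bigl => i; rewrite eqxx.
Qed.

Lemma edge_sym (R : realType) (N : nat) (G : grid R N) : symmetric (edge G).
Proof. by move=> a b; rewrite /edge line_sym. Qed.

Lemma edge_irr (R : realType) (N : nat) (G : grid R N) : irreflexive (edge G).
Proof. by move=> a; rewrite /edge line_irr. Qed.

Lemma bus_susc_sym (R : realType) (N : nat) (G : grid R N) (a b : 'I_N) :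
  edge G a b -> bus_susc G a b = bus_susc G b a.
Proof. exact: susc_sym. Qed.

Lemma reduced_laplacianT (R : realType) (N : nat) (G : grid R N) :
  (reduced_laplacian G)^T = reduced_laplacian G.
Proof.
apply/matrixP => a b; rewrite !mxE eq_sym.
case: eqVneq => [->//|_]; rewrite edge_sym.
by case: ifP => // ab; rewrite bus_susc_sym // edge_sym.
Qed.

(* [oapp x 0] extends [x] by 0 at the reference bus. *)
Lemma reduced_laplacian_mulE (R : realType) (N : nat) (G : grid R N)
    (x : 'cV[R]_N) (a : 'I_N) :
  let y := oapp (fun b => x b 0) 0 in
  (reduced_laplacian G *m x) a 0 =
  \sum_(k | line G (Some a) k) susc G (Some a) k * (y (Some a) - y k).
Proof.
move=> y; rewrite mxE (bigD1 a) //= mxE eqxx.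
under [RHS]eq_bigr do rewrite mulrBr.
rewrite sumrB -mulr_suml; congr (_ + _).
have -> : \sum_(k | line G (Some a) k) susc G (Some a) k * y k =
    \sum_(b | edge G a b) bus_susc G a b * x b 0.
  rewrite big_mkcond big_option /= mulr0 if_same add0r.
  by rewrite -big_mkcond.
rewrite -sumrN [RHS]big_mkcond [LHS]big_mkcond; apply: eq_bigr => b _.
rewrite mxE eq_sym; case: eqVneq => [->|ab] /=; first by rewrite edge_irr.
by case: ifP => _; rewrite ?mul0r // mulNr.
Qed.

(* Maximum principle: a maximum attained at a non-reference bus spreads along
   the lines, and so reaches the reference bus. *)
Lemma reduced_laplacian_ker_le0 (R : realType) (N : nat) (G : grid R N)
    (x : 'cV[R]_N) (a : 'I_N) :
  reduced_laplacian G *m x = 0 -> x a 0 <= 0.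
Proof.
move=> Hx0; pose y := oapp (fun b => x b 0) 0.
case: (arg_maxP (y : option 'I_N -> R) (isT : xpredT None)) => m _ ymax.
apply: (le_trans (ymax (Some a) isT)); rewrite leNgt; apply/negP => ym0.
(* At a maximum [b] every term [susc * (y b - y k)] of row [b] is nonnegative, and the row sums to
   0, so each term vanishes. The reference bus cannot be such a [b]: there [y] is 0, while [y m] is
   positive. *)
have step b k : y b = y m -> line G b k -> y k = y m.
  case: b => [b|] yb bk; last by rewrite -yb ltxx in ym0.
  have := congr1 (fun A : 'cV_N => A b 0) Hx0.
  rewrite reduced_laplacian_mulE mxE => /eqP.
  rewrite psumr_eq0 => [/allP /(_ k (mem_index_enum _)) /implyP /(_ bk)|l bl].
    rewrite mulf_eq0 gt_eqF ?susc_gt0 //= subr_eq0 => /eqP xbk.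
    exact: etrans (esym xbk) yb.
  rewrite mulr_ge0 ?(ltW (susc_gt0 bl)) // subr_ge0.
  by apply: le_trans (ymax l isT) _; rewrite -yb.
have ynone : y None = y m.
  have /connectP[s] := line_connected G m None.
  have: y m = y m by [].
  (* Only the start of the path is generalized: [m] stays the maximizer, and [y b = y m] is the
     invariant carried along the path. *)
  move: {1 3 4}m => b; elim: s b => [|c s IHs] b yb; first by move=> _ ->.
  by case/andP => bc; apply: IHs; apply: step bc.
by rewrite -ynone /y /= ltxx in ym0.
Qed.

(** The maximum principle, applied to a kernel vector and to its negative, bounds every entry by 0
    from both sides. *)
Lemma reduced_laplacian_unit (R : realType) (N : nat) (G : grid R N) :
  reduced_laplacian G \in unitmx.
Proof.
rewrite -row_free_unit; apply: inj_row_free => v vH0.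
have Hv0 : reduced_laplacian G *m v^T = 0.
  by rewrite -[X in X *m _]reduced_laplacianT -trmx_mul vH0 trmx0.
apply/rowP => a; apply/eqP; rewrite mxE eq_le.
have := reduced_laplacian_ker_le0 a Hv0; rewrite mxE => -> /=.
have HvN0 : reduced_laplacian G *m - v^T = 0 by rewrite mulmxN Hv0 oppr0.
by have := reduced_laplacian_ker_le0 a HvN0; rewrite !mxE oppr_le0.
Qed.

(** * Off-diagonal entries of the precision matrix and their sign *)

Lemma is_diag_mx_inv (R : realType) (N : nat) (S : 'M[R]_N) :
  is_diag_mx S -> (forall a, S a a != 0) ->
  S \in unitmx /\ invmx S = diag_mx (\row_a (S a a)^-1).
Proof.
move=> /is_diag_mxP Sdiag Sn0.
have SE : S = diag_mx (\row_a S a a).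
  apply/matrixP => a b; rewrite !mxE; case: eqVneq => [->//|ab].
  exact: Sdiag.
have Sinv : S *m diag_mx (\row_a (S a a)^-1) = 1%:M.
  rewrite {1}SE mulmx_diag -diag_const_mx; congr diag_mx.
  by apply/rowP => a; rewrite !mxE divff.
have [Su _] := mulmx1_unit Sinv; split=> //.
by apply: (can_inj (mulKmx Su)); rewrite mulmxV.
Qed.

(** The terms [k = i] and [k = j] each pair a diagonal entry with [- bus_susc G i j]. In any other
    term both factors are off-diagonal, their signs cancel, and the product survives only at a
    common neighbor. *)
Lemma reduced_laplacian_sandwichE (R : realType) (N : nat) (G : grid R N)
    (s : 'I_N -> R) (i j : 'I_N) : edge G i j ->
  (reduced_laplacian G *m diag_mx (\row_a (s a)^-1) *m reduced_laplacian G) i j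
  = \sum_(k in common_neighbors G i j) bus_susc G i k * bus_susc G j k / s k
    - bus_susc G i j * (total_susc G i / s i + total_susc G j / s j).
Proof.
move=> hij; have ij : i != j by apply: contraTneq hij => ->; rewrite edge_irr.
rewrite mxE; under eq_bigr do rewrite mul_mx_diag !mxE.
rewrite (bigD1 i) //= (bigD1 j) 1?eq_sym //= !eqxx eq_sym (negPf ij) hij.
set K := \sum_(k | _) _; set K' := \sum_(k in _) _.
suff -> : K = K' by ring.
rewrite /K /K' [LHS]big_mkcond [RHS]big_mkcond; apply: eq_bigr => k _.
rewrite inE (eq_sym i k) (edge_sym _ k j).
case: (eqVneq k i) => [->|ki] /=; first by rewrite edge_irr.
case: (eqVneq k j) => [->|kj] /=; first by rewrite edge_irr andbF.
case: ifP => //= ik; last by rewrite !mul0r.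
case: ifP => //= jk; last by rewrite mulr0.
by rewrite (bus_susc_sym jk); ring.
Qed.

Lemma sandwich_entry_lt0 (R : realType) (si sj b B D q : R) :
  0 < si -> 0 < sj ->
  let c := (sj * (B - b) + si * (D - b)) / (2 * (si + sj)) in
  b > - c + Num.sqrt (c ^+ 2 + si * sj / (si + sj) * q) ->
  q - b * (B / si + D / sj) < 0.
Proof.
move=> si0 sj0 c hb; have s0 : 0 < si + sj by rewrite addr_gt0.
have cb : c ^+ 2 + si * sj / (si + sj) * q < (b + c) ^+ 2.
  set r := c ^+ 2 + _ in hb *.
  have rbc : Num.sqrt r < b + c by move: hb; lra.
  (* Nothing is assumed on the sign of [q], so the radicand may be negative; it is then below any
     square. *)
  have [r0|r0] := leP 0 r; last by apply: lt_le_trans r0 _; exact: sqr_ge0.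
  have bc0 := le_lt_trans (sqrtr_ge0 r) rbc.
  by rewrite -(sqr_sqrtr r0) ltr_pXn2r // nnegrE ?sqrtr_ge0 // ltW.
have := cb; rewrite -subr_gt0.
(* Completing the square: [b + 2 * c = (sj * B + si * D) / (si + sj)], the [b] terms cancelling. *)
have -> : (b + c) ^+ 2 - (c ^+ 2 + si * sj / (si + sj) * q) =
    si * sj / (si + sj) * - (q - b * (B / si + D / sj)).
  by rewrite /c; field; rewrite !gt_eqF //=; lra.
by rewrite pmulr_rgt0 ?oppr_gt0 // divr_gt0 ?mulr_gt0.
Qed.

(** * The second moment of the standard normal law is finite and positive *)

Section std_normal.
Context {R : realType}.
Local Open Scope ereal_scope.
Local Notation mu := (@lebesgue_measure R).

(** The Radon-Nikodym derivative and [normal_pdf] have the same integral over every measurable set,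
    so they agree almost everywhere. *)
Lemma ge0_integral_normal_prob (m s : R) (f : _ -> \bar R) :
  (forall x, 0 <= f x) -> measurable_fun setT f ->
  \int[normal_prob m s]_x f x = \int[mu]_x (f x * (normal_pdf m s x)%:E).
Proof.
move=> f0 mf; have dom := normal_prob_dominates m s.
rewrite -(Radon_Nikodym_SigmaFinite.change_of_variables dom) //.
have iRN := Radon_Nikodym_SigmaFinite.f_integrable dom.
apply: ae_eq_integral => //.
- by apply: emeasurable_funM => //; exact: measurable_int iRN.
- apply: emeasurable_funM => //; apply/measurable_EFinP.
  exact: measurable_normal_pdf.
apply: ae_eqe_mul2l; apply: integral_ae_eq; [by []|exact: iRN| |].
- by apply/measurable_EFinP; exact: measurable_normal_pdf.
- by move=> E _ mE; rewrite -Radon_Nikodym_SigmaFinite.f_integral.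
Qed.

(* [x^2 <= 4 exp (x^2 / 4)]; the leftover factor [exp (- x^2 / 4)] is, up to
   scaling, the density of N(0, 2). *)
Lemma sqr_normal_pdf_le (x : R) :
  (x ^+ 2 * normal_pdf 0 1 x <=
   4 * normal_peak 1 / normal_peak (Num.sqrt 2) *
     normal_pdf 0 (Num.sqrt 2) x)%R.
Proof.
have s20 : (Num.sqrt 2 != 0 :> R)%R by rewrite sqrtr_eq0 -ltNge.
rewrite !normal_pdfE ?oner_neq0 // /normal_fun subr0 sqr_sqrtr // expr1n.
set p := normal_peak 1; set q := normal_peak _.
have q0 : (q != 0)%R by rewrite gt_eqF // normal_peak_gt0.
have p0 : (0 <= p)%R by exact: normal_peak_ge0.
rewrite [leRHS](_ : _ = (4 * expR (- x ^+ 2 / (2 *+ 2))) * p)%R; last first.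
  by field.
set e := expR (- x ^+ 2 / (2 *+ 2)).
have -> : expR (- x ^+ 2 / (1 *+ 2)) = (e * e)%R.
  by rewrite -expRD; congr expR; rewrite !mulr2n; field.
rewrite [leLHS](_ : _ = x ^+ 2 * e * e * p)%R; last by ring.
rewrite /e !ler_wpM2r ?expR_ge0 // mulNr expRN ler_pdivrMr ?expR_gt0 //.
have := expR_ge1Dx (x ^+ 2 / (2 *+ 2)).
by rewrite (_ : 2 *+ 2 = 4 :> R)%R; [lra|rewrite mulr2n; lra].
Qed.

(** Domination by a constant multiple of the density of N(0, 2), which has integral 1. *)
Lemma std_normal_sqr_lty :
  \int[normal_prob (0 : R) 1]_x (x ^+ 2)%:E < +oo.
Proof.
rewrite ge0_integral_normal_prob => [|x|]; last 2 first.
- by rewrite lee_fin sqr_ge0.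
- by apply/measurable_EFinP; exact: exprn_measurable.
pose c := (4 * normal_peak 1 / normal_peak (Num.sqrt 2) : R)%R.
apply: (@le_lt_trans _ _
  (\int[mu]_x (c%:E * (normal_pdf 0 (Num.sqrt 2) x)%:E))).
  apply: ge0_le_integral => //.
  - by move=> x _; rewrite mule_ge0 ?lee_fin ?sqr_ge0 ?normal_pdf_ge0.
  - apply/measurable_EFinP; apply: measurable_funM.
      exact: exprn_measurable.
    exact: measurable_normal_pdf.
  - apply/measurable_EFinP; apply: measurable_funM => //.
    exact: measurable_normal_pdf.
  - by move=> x _; rewrite -!EFinM lee_fin sqr_normal_pdf_le.
rewrite integralZl //; last exact: integrable_normal_pdf.
by rewrite integral_normal_pdf mule1 ltry.
Qed.

(** Otherwise the square vanishes almost everywhere, so the law is carried by the origin. But the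
    law is dominated by Lebesgue measure, for which a point is null, and its total mass is 1. *)
Lemma std_normal_sqr_gt0 :
  0 < \int[normal_prob (0 : R) 1]_x (x ^+ 2)%:E.
Proof.
rewrite lt0e integral_ge0 ?andbT; last by move=> x _; rewrite lee_fin sqr_ge0.
have m2 : measurable_fun setT (fun x : R => (x ^+ 2)%:E).
  by apply/measurable_EFinP; exact: exprn_measurable.
apply/eqP => int0.
have /ae_eq_integral_abs : \int[normal_prob (0 : R) 1]_x `|(x ^+ 2)%:E| = 0.
  rewrite -[RHS]int0; apply: eq_integral => x _.
  by rewrite gee0_abs // lee_fin sqr_ge0.
case=> // N [mN N0 subN].
have : normal_prob (0 : R) 1 setT <= normal_prob (0 : R) 1 (N `|` [set 0%R]).
  apply: le_measure; rewrite ?inE //; first exact: measurableU.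
  move=> x _; have [->|x0] := eqVneq x 0%R; first by right.
  left; apply: subN => /= /(_ I) [] /eqP; rewrite sqrf_eq0.
  by rewrite (negPf x0).
apply/negP; rewrite -ltNge.
have -> : normal_prob (0 : R) 1 (N `|` [set 0%R]) = 0.
  have /null_content_dominatesP dom := normal_prob_dominates (0 : R) 1.
  rewrite measureU0 //; apply: dom => //; exact: lebesgue_measure_set1.
by rewrite [X in _ < X]probability_setT.
Qed.

End std_normal.

Definition std_normal_second_moment (R : realType) : R :=
  fine (\int[normal_prob (0 : R) 1]_x (x ^+ 2)%:E)%E.

Lemma std_normal_second_moment_gt0 (R : realType) :
  0 < std_normal_second_moment R.
Proof. by rewrite fine_gt0 // std_normal_sqr_gt0 std_normal_sqr_lty. Qed.

Lemma std_normal_second_momentE (R : realType) :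
  (\int[normal_prob (0 : R) 1]_x (x ^+ 2)%:E)%E =
  (std_normal_second_moment R)%:E.
Proof.
by rewrite fineK // gt0_fin_numE ?std_normal_sqr_lty ?std_normal_sqr_gt0.
Qed.

(** * Covariances of linear combinations of a centred Gaussian vector *)

Lemma ge0_integral_law (d : measure_display) (T : measurableType d)
    (R : realType) (P : probability T R) (X : T -> measurableTypeR R)
    (mu : {measure set (measurableTypeR R) -> \bar R})
    (f : measurableTypeR R -> \bar R) :
  measurable_fun setT X ->
  (forall A, measurable A -> P (X @^-1` A)%classic = mu A) ->
  measurable_fun setT f -> (forall x, 0 <= f x)%E ->
  (\int[P]_w f (X w) = \int[mu]_x f x)%E.
Proof.
move=> mX law mf f0.
have := ge0_integral_pushforward mX P measurableT mf (fun x _ => f0 x).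
rewrite preimage_setT => <-.
by apply: eq_measure_integral => A mA _; exact: law.
Qed.

Definition lincomb (d : measure_display) (T : measurableType d) (R : realType)
    (P : probability T R) (n : nat) (X : 'I_n -> {RV P >-> R}) (u : 'rV[R]_n) :
    T -> R :=
  fun w => \sum_a u 0 a * X a w.

Section lincomb.
Context (d : measure_display) (T : measurableType d) (R : realType)
  (P : probability T R) (n : nat) (X : 'I_n -> {RV P >-> R}).
Implicit Types u v : 'rV[R]_n.

Lemma measurable_lincomb u : measurable_fun setT (lincomb X u).
Proof. by apply: measurable_sum => a; exact: measurable_funM. Qed.

HB.instance Definition _ u :=
  isMeasurableFun.Build _ _ _ _ (lincomb X u) (measurable_lincomb u).

Lemma lincombD u v w : lincomb X (u + v) w = lincomb X u w + lincomb X v w.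
Proof.
by rewrite /lincomb -big_split; apply: eq_bigr => a _; rewrite mxE mulrDl.
Qed.

Lemma lincombZ c u w : lincomb X (c *: u) w = c * lincomb X u w.
Proof.
by rewrite /lincomb mulr_sumr; apply: eq_bigr => a _; rewrite mxE mulrA.
Qed.

Lemma lincombN u w : lincomb X (- u) w = - lincomb X u w.
Proof. by rewrite -scaleN1r lincombZ mulN1r. Qed.

End lincomb.

Section gaussian_covariance.
Context (d : measure_display) (T : measurableType d) (R : realType)
  (P : probability T R) (n : nat) (X : 'I_n -> {RV P >-> R}) (S : 'M[R]_n)
  (gX : gaussian_vector X 0 S)
  (S_gt0 : forall u : 'rV[R]_n, u != 0 -> 0 < (u *m S *m u^T) 0 0).
Implicit Types u v : 'rV[R]_n.
Let m2 := std_normal_second_moment R.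
Let q u v := (u *m S *m v^T) 0 0.

Let qZ c u : q (c *: u) (c *: u) = c ^+ 2 * q u u.
Proof.
by rewrite /q -!scalemxAl linearZ /= -scalemxAr scalerA [LHS]mxE.
Qed.

Let integral_lincomb_sqr u :
  (\int[P]_w (lincomb X u w ^+ 2)%:E = (m2 * q u u)%:E)%E.
Proof.
have [->|u0] := eqVneq u 0.
  rewrite /q !mul0mx mxE mulr0; apply: integral0_eq => w _.
  by rewrite -(scale0r (0 : 'rV_n)) lincombZ mul0r expr0n.
have qu0 : 0 < q u u by exact: S_gt0.
(* Dividing by the standard deviation gives a combination of variance 1, whose law is exactly
   [normal_prob 0 1]. *)
pose s := Num.sqrt (q u u); have s0 : 0 < s by rewrite sqrtr_gt0.
pose u' := s^-1 *: u.
have qu' : q u' u' = 1.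
  by rewrite qZ exprVn sqr_sqrtr ?(ltW qu0) // mulVf ?gt_eqF.
have law A : measurable A -> pushforward P (lincomb X u') A = normal_prob 0 1 A.
  case: gX => _ _ /(_ u') /[apply]; rewrite mulmx0 mxE /normal_law.
  by rewrite -/(q u' u') qu' oner_eq0 sqrtr1.
have m2f : measurable_fun setT (fun x : R => (x ^+ 2)%:E).
  by apply/measurable_EFinP; exact: exprn_measurable.
have : (\int[P]_w (lincomb X u' w ^+ 2)%:E = m2%:E)%E.
  rewrite -std_normal_second_momentE -(ge0_integral_law _ law) //.
  - exact: measurable_lincomb.
  - by move=> x; rewrite lee_fin sqr_ge0.
move=> Eu'.
have -> : u = s *: u' by rewrite scalerA mulfV ?gt_eqF // scale1r.
under eq_integral do rewrite lincombZ exprMn EFinM.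
rewrite ge0_integralZl_EFin ?sqr_ge0 //; last 2 first.
- by move=> w _; rewrite lee_fin sqr_ge0.
- by apply/measurable_EFinP; exact: measurable_funX.
rewrite Eu' -EFinM mulrC; congr (_ * _)%:E.
by rewrite qZ qu' mulr1.
Qed.

Let integrable_lincomb_sqr u :
  P.-integrable setT (fun w => (lincomb X u w ^+ 2)%:E).
Proof.
apply/integrableP; split.
  by apply/measurable_EFinP; exact: measurable_funX.
under eq_integral do rewrite gee0_abs ?lee_fin ?sqr_ge0 //.
by rewrite integral_lincomb_sqr ltry.
Qed.

(** Domination by the pointwise bound [|x| <= 1 + x ^+ 2]. *)
Let lincomb_Lfun1 u : lincomb X u \in Lfun P 1.
Proof.
apply/Lfun1_integrable.
apply: (@le_integrable _ _ _ _ _ measurableT _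
  (fun w => 1%:E + (lincomb X u w ^+ 2)%:E)%E).
- exact/measurable_EFinP.
- move=> w _; rewrite -EFinD lee_fin [leRHS]ger0_norm; last first.
    by rewrite addr_ge0 ?sqr_ge0.
  rewrite -[_ ^+ 2]real_normK ?num_real //.
  have := normr_ge0 (lincomb X u w); nra.
- by apply: integrableD => //; exact: finite_measure_integrable_cst.
Qed.

(** Domination by the pointwise bound [|x * y| <= x ^+ 2 + y ^+ 2]. *)
Let lincombM_Lfun1 u v : lincomb X u * lincomb X v \in Lfun P 1.
Proof.
apply/Lfun1_integrable.
apply: (@le_integrable _ _ _ _ _ measurableT _
  (fun w => (lincomb X u w ^+ 2)%:E + (lincomb X v w ^+ 2)%:E)%E).
- by apply/measurable_EFinP; exact: measurable_funM.
- move=> w _; rewrite -EFinD lee_fin [leRHS]ger0_norm; last first.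
    by rewrite addr_ge0 ?sqr_ge0.
  rewrite normrM -[lincomb X u w ^+ 2]real_normK ?num_real //.
  rewrite -[lincomb X v w ^+ 2]real_normK ?num_real //.
  have := normr_ge0 (lincomb X u w); have := normr_ge0 (lincomb X v w); nra.
- exact: integrableD.
Qed.

(* [u] and [- u] give the same centred law. *)
Let expectation_lincomb u : 'E_P[lincomb X u]%E = 0%E.
Proof.
have EN : 'E_P[lincomb X (- u)]%E = (- 'E_P[lincomb X u])%E.
  rewrite (_ : lincomb X (- u) = -1 \o* lincomb X u); last first.
    by apply/funext => w; rewrite lincombN /= mulrN1.
  by rewrite expectationZl // mulN1e.
have EE : 'E_P[lincomb X (- u)]%E = 'E_P[lincomb X u]%E.
  have pf v : 'E_P[lincomb X v]%E =
      (\int[distribution P (lincomb X v)]_x x%:E)%E.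
    rewrite unlock integral_distribution //.
    by move/Lfun1_integrable: (lincomb_Lfun1 v).
  rewrite !pf; apply: eq_measure_integral => A mA _.
  case: gX => _ _ law.
  rewrite /= /distribution /pushforward [LHS](law (- u) A mA) [RHS](law u A mA).
  by rewrite linearN /= !mulNmx mulmxN opprK !mulmx0 oppr0.
have := expectation_fin_num (lincomb_Lfun1 u).
move: EE; rewrite EN; case: ('E_P[_]%E) => // r [] rr _; congr EFin; lra.
Qed.

(** Polarization: in the second moment at [u + v] the pure terms are known, and symmetry of [S]
    merges the two mixed values of [q] into [2 * q u v]. *)
Let expectation_lincombM u v :
  'E_P[lincomb X u * lincomb X v]%E = (m2 * q u v)%:E.
Proof.
have E2 u' : 'E_P[lincomb X u' * lincomb X u']%E = (m2 * q u' u')%:E.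
  by rewrite unlock -integral_lincomb_sqr; apply: eq_integral => w _.
have qC : q v u = q u v.
  transitivity ((v *m S *m u^T)^T 0 0); first by rewrite [RHS]mxE.
  by rewrite !trmx_mul trmxK mulmxA; case: gX => ->.
have := E2 (u + v).
have -> : lincomb X (u + v) * lincomb X (u + v) =
    ((lincomb X u * lincomb X u \+ lincomb X v * lincomb X v) \+
     2 \o* (lincomb X u * lincomb X v)).
  by apply/funext => w /=; rewrite !fctE lincombD; ring.
rewrite expectationD ?Lfun_scale ?rpredD // expectationD // expectationZl //.
rewrite !E2.
have -> : q (u + v) (u + v) = q u u + q v v + 2 * q u v.
  have mxD (A B : 'M[R]_1) : (A + B) 0 0 = A 0 0 + B 0 0 by rewrite mxE.
  by move: qC; rewrite /q linearD /= !mulmxDl !mulmxDr !mxD => ->; ring.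
have := expectation_fin_num (lincombM_Lfun1 u v).
case: ('E_P[_]%E) => // r _; rewrite -EFinM -!EFinD => -[] h.
by congr EFin; lra.
Qed.

Lemma covariance_lincomb u v :
  covariance P (lincomb X u) (lincomb X v) =
  (std_normal_second_moment R * (u *m S *m v^T) 0 0)%:E.
Proof.
by rewrite covarianceE // !expectation_lincomb mule0 sube0 expectation_lincombM.
Qed.

End gaussian_covariance.

(** * Covariance of the phase angles and the sign of its inverse *)

(** The form is a sum of squares with positive weights. This provides the definiteness under which
    the Gaussian covariances were computed. *)
Lemma diag_mx_pos_def (R : realType) (n : nat) (S : 'M[R]_n) (u : 'rV[R]_n) :
  is_diag_mx S -> (forall a, 0 < S a a) -> u != 0 ->
  0 < (u *m S *m u^T) 0 0.
Proof.
move=> /is_diag_mxP Sdiag S_gt0 u0.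
have -> : (u *m S *m u^T) 0 0 = \sum_a S a a * u 0 a ^+ 2.
  rewrite mxE; apply: eq_bigr => a _.
  rewrite !mxE (bigD1 a) //= big1 => [|b ba].
    by rewrite addr0; ring.
  by rewrite Sdiag ?mulr0.
have term_ge0 a : 0 <= S a a * u 0 a ^+ 2 by rewrite mulr_ge0 ?sqr_ge0 ?ltW.
rewrite lt0r sumr_ge0 ?andbT // psumr_eq0 //; apply: contra u0 => /allP ua0.
apply/eqP/rowP => a; have := ua0 a (mem_index_enum a).
by rewrite mulf_eq0 gt_eqF // sqrf_eq0 mxE => /eqP.
Qed.

Lemma covariance_mx_theta (d : measure_display) (T : measurableType d)
    (R : realType) (P : probability T R) (N : nat) (G : grid R N)
    (Sigma_p : 'M[R]_N) (p theta : 'I_N -> {RV P >-> R}) :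
  dc_power_flow G Sigma_p p theta ->
  covariance_mx theta = std_normal_second_moment R *:
    (invmx (reduced_laplacian G) *m Sigma_p *m invmx (reduced_laplacian G)).
Proof.
case=> Sdiag S_gt0 gp flow; set K := invmx _.
have KC a b : K a b = K b a.
  transitivity (K^T b a); first by rewrite mxE.
  by rewrite /K trmx_inv reduced_laplacianT.
(* Solving the flow equation at each outcome turns a phase angle into a combination of the
   injections, with coefficients a row of the inverse Laplacian. *)
have thetaE a : (theta a : T -> R) = lincomb p (row a K).
  apply/funext => w; transitivity ((K *m \col_b p b w) a 0).
    by rewrite flow mulKmx ?reduced_laplacian_unit // mxE.
  by rewrite mxE; apply: eq_bigr => b _; rewrite !mxE.
apply/matrixP => a b; rewrite mxE !thetaE.
rewrite (covariance_lincomb gp) => [/=|u]; last exact: diag_mx_pos_def.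
rewrite [RHS]mxE -row_mul; congr (_ * _); rewrite !mxE; apply: eq_bigr => k _.
by rewrite !mxE (KC k b).
Qed.

Theorem theorem9 (d : measure_display) (T : measurableType d) (R : realType)
    (P : probability T R) (N : nat) (G : grid R N) (Sigma_p : 'M[R]_N)
    (p theta : 'I_N -> {RV P >-> R})
    (model : dc_power_flow G Sigma_p p theta)
    (i j : 'I_N) (hij : edge G i j) :
  let sigma a := Sigma_p a a in
  let beta := bus_susc G in
  let beta_tot := total_susc G in
  let c := (sigma j * (beta_tot i - beta i j) +
            sigma i * (beta_tot j - beta i j)) / (2 * (sigma i + sigma j)) in
  beta i j > - c + Num.sqrt (c ^+ 2 +
    sigma i * sigma j / (sigma i + sigma j) *
      \sum_(k in common_neighbors G i j) beta i k * beta j k / sigma k) ->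
  (invmx (covariance_mx theta)) i j < 0.
Proof.
move=> sigma beta beta_tot c hc.
rewrite (covariance_mx_theta model); case: model => Sdiag S_gt0 _ _.
have m2_gt0 := std_normal_second_moment_gt0 R.
have [Su Sinv] := is_diag_mx_inv Sdiag (fun a => lt0r_neq0 (S_gt0 a)).
have Hu := reduced_laplacian_unit G.
(* The second moment leaves the inverse as a positive scalar factor, so the sign of the entry is
   unaffected. *)
rewrite invmxZ ?unitmxZ ?unitmx_mul ?unitmx_inv ?Hu ?Su ?unitfE ?gt_eqF //.
set H := reduced_laplacian G in Hu *.
have -> : invmx (invmx H *m Sigma_p *m invmx H) = H *m invmx Sigma_p *m H.
  have Mu : invmx H *m Sigma_p *m invmx H \in unitmx.
    by rewrite !unitmx_mul !unitmx_inv Hu Su.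
  apply: (can_inj (mulKmx Mu)); rewrite mulmxV //.
  by rewrite !mulmxA mulmxKV // mulmxK // mulVmx.
rewrite Sinv mxE pmulr_rlt0 ?invr_gt0 // reduced_laplacian_sandwichE //.
exact: sandwich_entry_lt0 (S_gt0 i) (S_gt0 j) hc.
Qed.
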